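(* A Boolean function $f\colon\mathbb{B}^n\to\mathbb{B}$ is locally monotone if and only if $\vee_k\wedge_jf=\wedge_j\vee_kf$ holds for all $j,k\in[n]$ with $j\neq k$.
   Context: $\mathbb{B}=\{0,1\}$, $[n]=\{1,\dots,n\}$. For $k\in[n]$, $\mathbf{x}\in\mathbb{B}^n$, $a\in\mathbb{B}$, $\mathbf{x}_k^a$ is the tuple obtained from $\mathbf{x}$ by replacing its $k$-th component by $a$; $\Delta_kf(\mathbf{x})=f(\mathbf{x}_k^1)-f(\mathbf{x}_k^0)$ (computed in $\mathbb{R}$). The function $f$ is locally monotone if for every $k\in[n]$ and all $\mathbf{x},\mathbf{y}\in\mathbb{B}^n$ with $\sum_{i\in[n]\setminus\{k\}}|x_i-y_i|<2$ we have $\Delta_kf(\mathbf{x})\,\Delta_kf(\mathbf{y})\geq 0$. The lattice derivatives are $\wedge_kf(\mathbf{x})=\min(f(\mathbf{x}_k^0),f(\mathbf{x}_k^1))$ and $\vee_kf(\mathbf{x})=\max(f(\mathbf{x}_k^0),f(\mathbf{x}_k^1))$, regarded as functions on $\mathbb{B}^n$; $\vee_k\wedge_jf$ means $\vee_k(\wedge_jf)$. *)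

(* Defs.v *)
(* MathComp world; [reals] is used only for the type of real numbers. *)
From HB Require Import structures.
From mathcomp Require Import all_boot all_order all_algebra.
From mathcomp Require Import reals.

Set Implicit Arguments.
Unset Strict Implicit.
Unset Printing Implicit Defensive.

Import Order.TTheory GRing.Theory Num.Theory.
Local Open Scope ring_scope.

(* The index set [n] is rendered as 'I_n, with indices shifted by one. *)
Definition cube (n : nat) := {ffun 'I_n -> bool}.

Definition setc (n : nat) (x : cube n) (k : 'I_n) (a : bool) : cube n :=
  [ffun i => if i == k then a else x i].

(* b%:R sends false to 0 and true to 1 in R. *)
Definition pderiv (R : realType) (n : nat) (k : 'I_n) (f : cube n -> bool)
    (x : cube n) : R :=
  (f (setc x k true))%:R - (f (setc x k false))%:R.

Definition locally_monotone (R : realType) (n : nat) (f : cube n -> bool) :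
    Prop :=
  forall (k : 'I_n) (x y : cube n),
    \sum_(i < n | i != k) `|(x i)%:R - (y i)%:R| < 2 :> R ->
    0 <= pderiv R k f x * pderiv R k f y.

(* min and max are taken for the order false < true on bool. *)
Definition meet_deriv (n : nat) (k : 'I_n) (f : cube n -> bool) :
    cube n -> bool :=
  fun x => Order.min (f (setc x k false)) (f (setc x k true)).

Definition join_deriv (n : nat) (k : 'I_n) (f : cube n -> bool) :
    cube n -> bool :=
  fun x => Order.max (f (setc x k false)) (f (setc x k true)).

(* Main.v *)
(* On the square spanned by two directions j <> k, both the sign condition
   [Delta_j f(x_k^0) * Delta_j f(x_k^1) >= 0] and the commutation of the lattice
   derivatives at x fail exactly when f restricted to the square is the
   exclusive or of x_j and x_k, or its negation. Moreover, two points whose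
   distance outside j is less than 2 agree outside j, or differ outside j in a
   single coordinate k; in the first case the two factors are equal. *)
Require Import Defs.
From HB Require Import structures.
From mathcomp Require Import all_boot all_order all_algebra.
From mathcomp Require Import reals.

Set Implicit Arguments.
Unset Strict Implicit.
Unset Printing Implicit Defensive.

Import Order.TTheory GRing.Theory Num.Theory.
Local Open Scope ring_scope.

Lemma setcC (n : nat) (x : cube n) (j k : 'I_n) (a b : bool) :
  j != k -> setc (setc x j a) k b = setc (setc x k b) j a.
Proof.
move=> jk; apply/ffunP=> i; rewrite !ffunE.
by case: (eqVneq i k) => // ->; rewrite eq_sym (negPf jk).
Qed.

Lemma setc_id (n : nat) (x : cube n) (k : 'I_n) : setc x k (x k) = x.
Proof. by apply/ffunP=> i; rewrite ffunE; case: eqP => // ->. Qed.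

Lemma eq_pderiv (R : realType) (n : nat) (k : 'I_n) (f : cube n -> bool)
    (x y : cube n) :
  (forall i, i != k -> x i = y i) -> pderiv R k f x = pderiv R k f y.
Proof.
move=> xy; suff e a : setc x k a = setc y k a by rewrite /pderiv !e.
by apply/ffunP=> i; rewrite !ffunE; case: eqVneq => // /xy.
Qed.

Lemma lattice_deriv_commP (R : realType) (n : nat) (j k : 'I_n)
    (f : cube n -> bool) (x : cube n) : j != k ->
  join_deriv k (meet_deriv j f) x = meet_deriv j (join_deriv k f) x <->
  0 <= pderiv R j f (setc x k false) * pderiv R j f (setc x k true).
Proof.
(* Both sides depend only on the values of [f] at the four corners of the square, so sixteen cases
   remain. *)
move=> jk; rewrite /join_deriv /meet_deriv /pderiv !(setcC _ _ _ jk).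
move: (f _) (f _) (f _) (f _) => [] [] [] [];
  rewrite ?subrr ?subr0 ?sub0r ?mulr0 ?mul0r ?mulrNN ?mulrN ?mulNr ?mulr1;
  by rewrite ?lexx ?ler01 ?oppr_ge0 ?ler10; split.
Qed.

(** Each summand is 0 or 1; the bound 2 in [locally_monotone] thus allows at most one differing
    coordinate outside [k]. *)
Lemma sum_dist_card (R : realType) (n : nat) (k : 'I_n) (x y : cube n) :
  \sum_(i < n | i != k) `|(x i)%:R - (y i)%:R| =
  #|[set i | (i != k) && (x i != y i)]|%:R :> R.
Proof.
rewrite cardsE -sum1_card natr_sum big_mkcondr /=; apply: eq_bigr => i _.
by case: (x i) (y i) => [] []; rewrite ?subrr ?subr0 ?sub0r ?normrN ?normr0 ?normr1.
Qed.

Theorem theorem12 (R : realType) (n : nat) (f : cube n -> bool) :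
  locally_monotone R f <->
  (forall j k : 'I_n, j <> k ->
     join_deriv k (meet_deriv j f) =1 meet_deriv j (join_deriv k f)).
Proof.
split=> [mf j k /eqP jk x | comm j x y].
  apply/(lattice_deriv_commP R _ _ jk); apply: mf.
  rewrite sum_dist_card ltr_nat ltnS -(cards1 k); apply/subset_leq_card.
  apply/subsetP=> i; rewrite !inE !ffunE.
  by case: (i == k) => //; rewrite eqxx andbF.
rewrite sum_dist_card ltr_nat ltnS leq_eqVlt ltnS leqn0 cards_eq0.
case/orP=> [/cards1P[k Dk] | /eqP D0]; last first.
  rewrite (@eq_pderiv _ _ _ _ x y) -?expr2 ?sqr_ge0 // => i ij.
  by move/setP/(_ i): D0; rewrite !inE ij /= => /negbFE/eqP.
have /andP[kj xyk] : (k != j) && (x k != y k).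
  by move/setP/(_ k): Dk; rewrite !inE eqxx.
(* [y] may also differ from [x] at [j], but the derivative in direction [j] ignores that
   coordinate. *)
have -> : pderiv R j f y = pderiv R j f (setc x k (y k)).
  apply: eq_pderiv => i ij; rewrite ffunE; case: eqVneq => [->//|ik].
  move/setP/(_ i): Dk; rewrite !inE ij (negPf ik) /=.
  by move/negbFE/eqP.
have jk : j != k by rewrite eq_sym.
have /(lattice_deriv_commP R f x jk) := comm j k (elimN eqP jk) x.
(* With [x] written as [setc x k (x k)] and [x k != y k], the two points are [setc x k false] and
   [setc x k true] in some order; the product is symmetric. *)
rewrite -{3}(setc_id x k).
by case: (x k) (y k) xyk => [] [] // _; rewrite mulrC.
Qed.
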